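(* Let $\gamma\in\mathcal M_g$ be an arc-length parametrized curve with monodromy $g=(R,\vec b)\in \mathrm{SE}(3)$, and choose the origin on the screw axis of $g$ whenever $R\neq \mathrm{Id}$. Let $\vec\lambda_1,\vec\lambda_2\in\mathbb R^3$ be any vectors such that - $\vec\lambda_1$ is arbitrary if $g=\mathrm{id}$ and parallel to $\vec s_g$ otherwise; - $\vec\lambda_2$ is arbitrary if $R=\mathrm{Id}$ and parallel to $\vec s_g$ if $R\neq\mathrm{Id}$. Then the following are equivalent: (i) The functional $\mathscr L+\langle \mathscr V\mid\vec\lambda_1\rangle+\langle \mathscr A\mid\vec\lambda_2\rangle$ is stationary at $\gamma$ with respect to every variation $\mathring\gamma\in T_\gamma\mathcal M_g$, i.e. every smooth $\mathring{\vec\gamma}:\mathbb R\to\mathbb R^3$ with $\mathring{\vec\gamma}(\tau(t))=R\,\mathring{\vec\gamma}(t)$. (ii) The corresponding local first variation on the underlying infinite curve vanishes for every compactly supported variation $\mathring{\vec\gamma}\in C_0^\infty(\mathbb R,\mathbb R^3)$. Moreover, $\gamma$ is elastic if and only if there exists a pair $(\vec\lambda_1,\vec\lambda_2)$ satisfying the conditions above for which either, and hence both, of the equivalent conditions (i), (ii) holds.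
   Context: Fix a translation $\tau:\mathbb R\to\mathbb R$, $\tau(t)=t+T_0$ with $T_0>0$. An element $g=(R,\vec b)\in\mathrm{SE}(3)$, $R\in \mathrm{SO}(3)$, $\vec b\in\mathbb R^3$, acts by $g(\vec x)=R\vec x+\vec b$. $\mathcal M_g$ is the space of smooth immersions $\gamma:\mathbb R\to\mathbb R^3$ with $\gamma(\tau(t))=g(\gamma(t))$ for all $t$ (''quasi-periodic curves with monodromy $g$''; $\vec\gamma$ denotes the corresponding vector-valued function). Its tangent space $T_\gamma\mathcal M_g$ consists of smooth $X:\mathbb R\to\mathbb R^3$ with $X(\tau(t))=R\,X(t)$. A fundamental domain is an interval $I=[t_0,\tau(t_0)]$, $t_0\in\mathbb R$. $ds=|\partial_t\vec\gamma|\,dt$ is the arc-length measure and $'$ the arc-length derivative; a curve is arc-length parametrized if $|\partial_t\vec\gamma|=1$. If $R\ne\mathrm{Id}$, the origin is chosen on the screw axis of $g$, so that $R\vec b=\vec b$; $\vec s_g$ is a unit vector with $R\vec s_g=\vec s_g$, and $\vec b$ is parallel to $\vec s_g$. If $R=\mathrm{Id}$, $\vec b\neq0$, then $\vec s_g=\vec b/|\vec b|$. Functionals, evaluated on a fundamental domain $I=[t_0,\tau(t_0)]$: $\mathscr L(\gamma)=\int_I ds$, $\mathscr A(\gamma)=\tfrac12\int_I\vec\gamma\times\vec\gamma'\,ds-\tfrac12\vec b\times\vec\gamma(t_0)$, $\mathscr V(\gamma)=\tfrac13\int_I\vec\gamma\times(\vec\gamma\times\vec\gamma')\,ds-\tfrac16\vec\gamma(t_0)\times(\vec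 b\times\vec\gamma(t_0))$. For $\vec\lambda_1,\vec\lambda_2$ as in the claim, $\langle\mathscr V\mid\vec\lambda_1\rangle=\langle\vec\lambda_1,\mathscr V\rangle$ and $\langle\mathscr A\mid\vec\lambda_2\rangle=\langle\vec\lambda_2,\mathscr A\rangle$ do not depend on the choice of $I$. The local first variation in (ii), for $\mathring{\vec\gamma}$ compactly supported, is the derivative at $\varepsilon=0$ of $$\int_J\Big(|\dot\gamma_\varepsilon|+\tfrac13\langle\vec\lambda_1,\gamma_\varepsilon\times(\gamma_\varepsilon\times\dot\gamma_\varepsilon)\rangle+\tfrac12\langle\vec\lambda_2,\gamma_\varepsilon\times\dot\gamma_\varepsilon\rangle\Big)dt,\qquad \gamma_\varepsilon=\vec\gamma+\varepsilon\mathring{\vec\gamma},\ \dot\gamma_\varepsilon=\partial_t\gamma_\varepsilon,$$ where $J$ is any compact interval containing the support of $\mathring{\vec\gamma}$ in its interior. Elastic: an arc-length parametrized curve $\gamma$ is elastic if it is a critical point, under compactly supported variations, of the bending energy $\tfrac12\int|\vec\gamma''|^2ds$ under the constraints of fixed length and fixed holonomy (total torsion); that is, there are constants $\lambda_1,\lambda_2\in\mathbb R$ such that $$\vec\gamma''''+\tfrac32\langle\vec\gamma'',\vec\gamma''\rangle\vec\gamma''-\langle\vec\gamma'''',\vec\gamma'\rangle\vec\gamma'-\lambda_1\vec\gamma''-\lambda_2\,\vec\gamma'\times\vec\gamma'''=0 .$$ *)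

(* Defs.v *)
From mathcomp Require Import all_boot all_order all_algebra.
From mathcomp Require Import all_classical all_reals all_analysis.
Import Order.TTheory GRing.Theory Num.Theory numFieldNormedType.Exports.

Set Implicit Arguments.
Unset Strict Implicit.
Unset Printing Implicit Defensive.

Local Open Scope ring_scope.
Local Open Scope classical_set_scope.

Section euclidean_space.
Variable R : realType.
Implicit Types (u v s b : 'cV[R]_3) (Q : 'M[R]_3).

Definition dot u v : R := \sum_i u i 0 * v i 0.

(* The library norm `|u| on matrices is the sup norm, hence this one. *)
Definition enorm u : R := Num.sqrt (dot u u).

(* 'I_3 is the ring Z/3: indices are added modulo 3. *)
Definition cross u v : 'cV[R]_3 :=
  \col_k (u (k + 1) 0 * v (k + 2) 0 - u (k + 2) 0 * v (k + 1) 0).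

Definition parallel u v : Prop := exists c : R, u = c *: v.

Definition SO3 Q : Prop := Q *m Q^T = 1%:M /\ \det Q = 1.

(* Direction of the screw axis of x |-> Q x + b; it makes no sense for the
   identity motion. When Q is not the identity, it is unique up to sign. *)
Definition screw_direction Q b s : Prop :=
  [/\ enorm s = 1,
      Q <> 1%:M -> Q *m s = s &
      Q = 1%:M -> b <> 0 -> s = (enorm b)^-1 *: b].

Definition id_motion Q b : Prop := Q = 1%:M /\ b = 0.

Definition admissible Q b s (lambda1 lambda2 : 'cV[R]_3) : Prop :=
  (~ id_motion Q b -> parallel lambda1 s) /\
  (Q <> 1%:M -> parallel lambda2 s).

End euclidean_space.

Section curves.
Variable R : realType.
Implicit Types (gam X : R -> 'cV[R]_3) (b : 'cV[R]_3) (Q : 'M[R]_3).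

Definition smooth X : Prop := forall n t, derivable (derive1n n X) t 1.

(* The monodromy condition is relative to the translation t |-> t + T0. *)
Definition quasi_periodic (T0 : R) Q b gam : Prop :=
  [/\ smooth gam,
      forall t, derive1 gam t != 0 &
      forall t, gam (t + T0) = Q *m gam t + b].

Definition tangent_space (T0 : R) Q X : Prop :=
  smooth X /\ forall t, X (t + T0) = Q *m X t.

Definition speed gam (t : R) : R := enorm (derive1 gam t).

Definition arclength_derivative gam (t : R) : 'cV[R]_3 :=
  (speed gam t)^-1 *: derive1 gam t.

Definition arclength_parametrized gam : Prop := forall t, speed gam t = 1.

Definition arclength_integral gam (t0 t1 : R) X : 'cV[R]_3 :=
  \col_i \int[lebesgue_measure]_(t in `[t0, t1]) (X t i 0 * speed gam t).

Definition length_functional (T0 t0 : R) gam : R :=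
  \int[lebesgue_measure]_(t in `[t0, t0 + T0]) speed gam t.

Definition area_functional (T0 t0 : R) b gam : 'cV[R]_3 :=
  2^-1 *: arclength_integral gam t0 (t0 + T0)
            (fun t => cross (gam t) (arclength_derivative gam t))
  - 2^-1 *: cross b (gam t0).

Definition volume_functional (T0 t0 : R) b gam : 'cV[R]_3 :=
  3^-1 *: arclength_integral gam t0 (t0 + T0)
            (fun t => cross (gam t)
                        (cross (gam t) (arclength_derivative gam t)))
  - 6^-1 *: cross (gam t0) (cross b (gam t0)).

Definition total_functional (T0 t0 : R) b (lambda1 lambda2 : 'cV[R]_3) gam : R :=
  length_functional T0 t0 gam
  + dot lambda1 (volume_functional T0 t0 b gam)
  + dot lambda2 (area_functional T0 t0 b gam).

Definition stationary (T0 t0 : R) Q b (lambda1 lambda2 : 'cV[R]_3) gam : Prop :=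
  forall X, tangent_space T0 Q X ->
    is_derive (0 : R) (1 : R)
      (fun e : R =>
         total_functional T0 t0 b lambda1 lambda2 (fun t => gam t + e *: X t))
      (0 : R).

Definition supp X : set R := closure [set t | X t != 0].

Definition local_functional (a c : R) (lambda1 lambda2 : 'cV[R]_3) gam : R :=
  \int[lebesgue_measure]_(t in `[a, c])
    (enorm (derive1 gam t)
     + 3^-1 * dot lambda1 (cross (gam t) (cross (gam t) (derive1 gam t)))
     + 2^-1 * dot lambda2 (cross (gam t) (derive1 gam t))).

Definition locally_stationary (lambda1 lambda2 : 'cV[R]_3) gam : Prop :=
  forall X, smooth X -> compact (supp X) ->
  forall a c : R, supp X `<=` `]a, c[ ->
    is_derive (0 : R) (1 : R)
      (fun e : R =>
         local_functional a c lambda1 lambda2 (fun t => gam t + e *: X t))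
      (0 : R).

(* Euler-Lagrange equation of the bending energy at fixed length and total
   torsion; meant for arc-length parametrized curves, for which the arc-length
   derivatives are the derivatives in the parameter. *)
Definition elastic gam : Prop :=
  exists l1 l2 : R, forall t,
    derive1n 4 gam t
    + (3 / 2 * dot (derive1n 2 gam t) (derive1n 2 gam t)) *: derive1n 2 gam t
    - dot (derive1n 4 gam t) (derive1n 1 gam t) *: derive1n 1 gam t
    - l1 *: derive1n 2 gam t
    - l2 *: cross (derive1n 1 gam t) (derive1n 3 gam t) = 0.

End curves.

(* Main.v *)
Require Import Defs.
From mathcomp Require Import all_boot all_order all_algebra.
From mathcomp Require Import all_classical all_reals all_analysis.
From mathcomp Require Import ring lra.
Import Order.TTheory GRing.Theory Num.Theory numFieldNormedType.Exports.
Local Open Scope ring_scope.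
Local Open Scope classical_set_scope.

(** Write [T] for the unit tangent of [gam].  The first variation of the
    Lagrangian in a direction [X] is
      <E, X> + d/dt P(X),   E = T x (lambda1 x gam + lambda2) - gam'',
    where [P(X)] is the momentum [boundary_term].  For a compactly supported [X]
    the momentum contributes nothing.  For [X] in the tangent space of [M_g],
    its increment over a period is compensated by the derivative of the
    correction terms at [t0] ([boundary_term_monodromy]): this uses that the
    monodromy fixes both multipliers and that [lambda1] is parallel to [b], which
    admissibility guarantees ([admissible_monodromy_invariant]).  Hence
    both notions of stationarity say that [E] is orthogonal, in the L2 sense, to
    their variations.  The field [E] satisfies [E(t + T0) = Q E(t)], so it is
    itself a tangent vector, and [E] times a bump function is a compactly supported
    variation.  Either way stationarity is equivalent to [E = 0]
    ([stationary_euler_lagrange], [locally_stationary_euler_lagrange]).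

    Differentiation under the integral needs one estimate.  All terms but the
    length are polynomial in the parameter, and
      0 <= |T + e X'| - 1 - e <T, X'> <= e^2 |X'|^2 / 2
    for every [e], because [T] is a unit vector ([enorm_expansion]).

    The equation [E = 0] is that of an elastic curve by Kirchhoff's analogy.
    The elastic equation with constants [a] and [m] says that the derivative of
      force  = T'' + 3/2 |T'|^2 T - a T - m T x T'
    vanishes, and [force x T] is the derivative of
      moment = - m T - T x T'.
    If [force] is a constant [lambda1], then [moment - lambda1 x gam] is a
    constant [lambda2], and [T x moment = T'] is the equation [E = 0].  The pair is
    admissible since force and moment are rotated by the monodromy, and the fixed
    vectors of a nontrivial rotation form a line ([parallel_axis]).  Conversely,
    when [E = 0], put [W = lambda1 x gam + lambda2]; then [<T, W>] and
    [|W|^2 - 2 <T, lambda1>] are conserved, and they determine [m] and [a] for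
    which the force equals [lambda1]. *)

(** * Dot and cross products, and rotations of space *)

Section vector_algebra.
Set Implicit Arguments.
Unset Strict Implicit.
Variable R : realType.
Implicit Types (u v w x s b : 'cV[R]_3) (Q : 'M[R]_3) (k : R).

Let i0 : 'I_3 := ord0.
Let i1 : 'I_3 := lift ord0 ord0.
Let i2 : 'I_3 := lift ord0 (lift ord0 ord0).

Lemma dot3E u v :
  dot u v = u i0 0 * v i0 0 + u i1 0 * v i1 0 + u i2 0 * v i2 0.
Proof. by rewrite /dot !big_ord_recl big_ord0 addr0 addrA. Qed.

Lemma cross3E u v : (cross u v i0 0 = u i1 0 * v i2 0 - u i2 0 * v i1 0) *
  (cross u v i1 0 = u i2 0 * v i0 0 - u i0 0 * v i2 0) *
  (cross u v i2 0 = u i0 0 * v i1 0 - u i1 0 * v i0 0).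
Proof.
have a01 : i0 + 1 = i1 by apply/val_inj.
have a02 : i0 + 2 = i2 by apply/val_inj.
have a11 : i1 + 1 = i2 by apply/val_inj.
have a12 : i1 + 2 = i0 by apply/val_inj.
have a21 : i2 + 1 = i0 by apply/val_inj.
have a22 : i2 + 2 = i1 by apply/val_inj.
by rewrite !mxE a01 a02 a11 a12 a21 a22.
Qed.

Lemma vec3P u v : u i0 0 = v i0 0 -> u i1 0 = v i1 0 -> u i2 0 = v i2 0 -> u = v.
Proof.
move=> h0 h1 h2; apply/colP => -[[|[|[|//]]] hi].
- by rewrite (_ : Ordinal hi = i0) //; apply/val_inj.
- by rewrite (_ : Ordinal hi = i1) //; apply/val_inj.
- by rewrite (_ : Ordinal hi = i2) //; apply/val_inj.
Qed.

Ltac coordinates :=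
  rewrite ?dot3E; try apply: vec3P; rewrite ?(dot3E, cross3E, mxE); try ring.

Lemma dotC u v : dot u v = dot v u. Proof. by coordinates. Qed.
Lemma dotDl u v w : dot (u + v) w = dot u w + dot v w.
Proof. by coordinates. Qed.
Lemma dotZl k u v : dot (k *: u) v = k * dot u v. Proof. by coordinates. Qed.
Lemma dotDr u v w : dot u (v + w) = dot u v + dot u w. Proof. by coordinates. Qed.
Lemma dotNr u v : dot u (- v) = - dot u v. Proof. by coordinates. Qed.
Lemma dotZr k u v : dot u (k *: v) = k * dot u v. Proof. by coordinates. Qed.
Lemma dot0l u : dot 0 u = 0. Proof. by coordinates. Qed.
Lemma dot0r u : dot u 0 = 0. Proof. by coordinates. Qed.
Lemma crossDl u v w : cross (u + v) w = cross u w + cross v w.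
Proof. by coordinates. Qed.
Lemma crossNl u v : cross (- u) v = - cross u v. Proof. by coordinates. Qed.
Lemma crossZl k u v : cross (k *: u) v = k *: cross u v.
Proof. by coordinates. Qed.
Lemma crossDr u v w : cross u (v + w) = cross u v + cross u w.
Proof. by coordinates. Qed.
Lemma crossNr u v : cross u (- v) = - cross u v. Proof. by coordinates. Qed.
Lemma crossZr k u v : cross u (k *: v) = k *: cross u v.
Proof. by coordinates. Qed.
Lemma cross0l u : cross 0 u = 0. Proof. by coordinates. Qed.
Lemma cross0r u : cross u 0 = 0. Proof. by coordinates. Qed.
Lemma crossvv u : cross u u = 0. Proof. by coordinates. Qed.
Lemma crossC u v : cross u v = - cross v u. Proof. by coordinates. Qed.
Lemma dot_crossA u v w : dot u (cross v w) = dot (cross u v) w.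
Proof. by coordinates. Qed.
Lemma dot_crossr u v : dot v (cross u v) = 0. Proof. by coordinates. Qed.
Lemma cross_cross u v w :
  cross u (cross v w) = dot u w *: v - dot u v *: w.
Proof. by coordinates. Qed.

Lemma lagrange_identity u v :
  dot (cross u v) (cross u v) = dot u u * dot v v - dot u v ^+ 2.
Proof. by coordinates. Qed.

Lemma dot_ge0 u : 0 <= dot u u.
Proof. by apply: sumr_ge0 => i _; rewrite -expr2 sqr_ge0. Qed.

Lemma dot_eq0 u : dot u u = 0 -> u = 0.
Proof.
move=> /eqP; rewrite /dot psumr_eq0 => [/allP u0|i _]; last by rewrite -expr2 sqr_ge0.
apply/colP => i; rewrite mxE; apply/eqP.
by have := u0 i (mem_index_enum i); rewrite -expr2 sqrf_eq0.
Qed.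

Lemma enorm_sqr u : enorm u ^+ 2 = dot u u.
Proof. by rewrite sqr_sqrtr// dot_ge0. Qed.

Lemma enorm_eq0 u : enorm u = 0 -> u = 0.
Proof. by move=> u0; apply: dot_eq0; rewrite -enorm_sqr u0 expr0n. Qed.

Lemma cauchy_schwarz u v : dot u v ^+ 2 <= dot u u * dot v v.
Proof. by rewrite -subr_ge0 -lagrange_identity dot_ge0. Qed.

(** Both bounds hold for all [k], with no smallness: the lower one is the
    Cauchy-Schwarz inequality, the upper one is [2 N <= 1 + N ^ 2]. *)
Lemma enorm_expansion u v k : enorm u = 1 ->
  0 <= enorm (u + k *: v) - 1 - k * dot u v <= k ^+ 2 * (dot v v / 2).
Proof.
move=> u1; have uu1 : dot u u = 1 by rewrite -enorm_sqr u1 expr1n.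
set N := enorm _; have N0 : 0 <= N by exact: sqrtr_ge0.
have N2 : N ^+ 2 = 1 + 2 * k * dot u v + k ^+ 2 * dot v v.
  by rewrite enorm_sqr dotDl !dotDr !dotZl !dotZr uu1 (dotC v u); ring.
have cs : dot u v ^+ 2 <= dot v v by have := cauchy_schwarz u v; rewrite uu1 mul1r.
set a := dot u v in N2 cs *; set q := dot v v in N2 cs *.
apply/andP; split; last first.
  have := sqr_ge0 (N - 1).
  rewrite (_ : (N - 1) ^+ 2 = N ^+ 2 - 2 * N + 1); last by ring.
  by rewrite N2; lra.
have [ka|ka] := leP (1 + k * a) 0; first by lra.
rewrite -addrA -opprD subr_ge0 -(@ler_pXn2r _ 2)// ?nnegrE//; last exact: ltW.
rewrite N2 -subr_ge0.
rewrite (_ : _ - _ = k ^+ 2 * (q - a ^+ 2)); last by ring.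
by rewrite mulr_ge0// ?sqr_ge0 ?subr_ge0.
Qed.

Lemma dot_mulmx Q u v : SO3 Q -> dot (Q *m u) (Q *m v) = dot u v.
Proof.
move=> [/mulmx1C QTQ _].
have dotE x y : dot x y = (x^T *m y) 0 0.
  by rewrite mxE; apply: eq_bigr => i _; rewrite mxE.
by rewrite !dotE trmx_mul mulmxA -(mulmxA _ _ Q) QTQ mulmx1.
Qed.

Let columns u v w : 'M[R]_3 := \matrix_(i, j) tnth [tuple u; v; w] j i 0.

(** The triple product is a determinant; it is how the hypothesis on the
    determinant of a rotation enters. *)
Lemma det_columns u v w : \det (columns u v w) = dot u (cross v w).
Proof.
rewrite dot3E !cross3E (expand_det_row _ i0) !big_ord_recl big_ord0 /cofactor.
rewrite !(expand_det_row _ (ord0 : 'I_2)) !big_ord_recl !big_ord0 /cofactor !det_mx11.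
have l1 : lift i0 (ord0 : 'I_2) = i1 by apply/val_inj.
have l2 : lift i0 (lift ord0 (0 : 'I_1)) = i2 by apply/val_inj.
by rewrite !mxE !(tnth_nth 0) /= l1 l2 -/i0; ring.
Qed.

Lemma triple_mulmx Q u v w :
  dot (Q *m u) (cross (Q *m v) (Q *m w)) = \det Q * dot u (cross v w).
Proof.
rewrite -!det_columns -det_mulmx; congr (\det _).
apply/matrixP => i j; rewrite !mxE.
case: j => -[|[|[|//]]] hj; rewrite !(tnth_nth 0) /= mxE; apply: eq_bigr => k _;
  by rewrite !mxE !(tnth_nth 0).
Qed.

Lemma dot_inj u v : (forall w, dot w u = dot w v) -> u = v.
Proof.
move=> uv; apply/subr0_eq/dot_eq0.
by rewrite dotDr dotNr uv subrr.
Qed.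

(** Tested against the vectors [Q w], both sides are triple products, which a
    rotation preserves. *)
Lemma cross_mulmx Q u v : SO3 Q -> cross (Q *m u) (Q *m v) = Q *m cross u v.
Proof.
move=> QSO; apply: dot_inj => w.
have [QQT detQ] := QSO.
have -> : w = Q *m (Q^T *m w) by rewrite mulmxA QQT mul1mx.
by rewrite triple_mulmx detQ mul1r dot_mulmx.
Qed.

(** The vectors [u], [v] and [cross u v] form a basis, and all three are fixed. *)
Lemma fixed_basis Q u v : SO3 Q -> Q *m u = u -> Q *m v = v -> cross u v != 0 ->
  Q = 1%:M.
Proof.
move=> QSO Qu Qv; set w := cross u v => w0.
have Qw : Q *m w = w by rewrite -cross_mulmx// Qu Qv.
have ww0 : dot w w != 0 by apply: contra w0 => /eqP/dot_eq0 ->.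
have Qx x : Q *m x = x.
  (* Expansion of [x] in the basis [u], [v], [w], up to the factor [dot w w]. *)
  have xE : dot w w *: x = dot x (cross v w) *: u + dot x (cross w u) *: v + dot x w *: w.
    by rewrite /w; coordinates.
  apply: (scalerI ww0).
  by rewrite scalemxAr xE !mulmxDr -!scalemxAr Qu Qv Qw.
apply/trmx_inj/row_matrixP => j.
rewrite -!tr_col; congr (_^T).
by rewrite !colE mul1mx Qx.
Qed.

(** A fixed vector independent of the axis would force [Q] to be the identity by
    [fixed_basis]. *)
Lemma parallel_axis Q u s : SO3 Q -> Q <> 1%:M -> enorm s = 1 -> Q *m s = s ->
  Q *m u = u -> parallel u s.
Proof.
move=> QSO Q1 s1 Qs Qu; exists (dot s u).
have us0 : cross u s = 0.
  by apply/eqP; apply: contra_notT Q1 => us; apply: fixed_basis Qu Qs us.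
have := cross_cross s u s.
by rewrite us0 cross0r -(enorm_sqr s) s1 expr1n scale1r => /esym/subr0_eq.
Qed.

Lemma parallel_of_cross0 u b : b <> 0 -> cross u b = 0 ->
  parallel u ((enorm b)^-1 *: b).
Proof.
move=> b0 ub0; have nb0 : enorm b != 0 by apply/eqP => /enorm_eq0.
exists (dot b u / enorm b); rewrite scalerA.
have := cross_cross b u b; rewrite ub0 cross0r => /esym/subr0_eq bbu.
rewrite (_ : _ / _ / _ = (dot b b)^-1 * dot b u); last first.
  by rewrite -enorm_sqr; field.
rewrite -scalerA -bbu scalerA mulVf ?scale1r//.
by rewrite -enorm_sqr sqrf_eq0.
Qed.

Lemma parallel_cross0 u v s : parallel u s -> parallel v s -> cross u v = 0.
Proof. by move=> [k ->] [l ->]; rewrite crossZl crossZr crossvv !scaler0. Qed.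


(** * First variation of the Lagrangian at a point *)

Definition lagrangian (l1 l2 u v : 'cV[R]_3) : R :=
  enorm v + 3^-1 * dot l1 (cross u (cross u v)) + 2^-1 * dot l2 (cross u v).

(** Derivative of the Lagrangian at position [u] and velocity [v], in the
    direction [x] with velocity [y], when [v] is a unit vector. *)
Definition lagrangian_variation (l1 l2 u v x y : 'cV[R]_3) : R :=
  dot v y
  + 3^-1 * dot l1 (cross x (cross u v) + cross u (cross x v) + cross u (cross u y))
  + 2^-1 * dot l2 (cross x v + cross u y).

(** Absolute values of the coefficients of degree two and three in the parameter;
    for a parameter of absolute value at most one they bound the remainder together. *)
Definition lagrangian_remainder (l1 l2 u v x y : 'cV[R]_3) : R :=
  dot y y / 2
  + `|3^-1 * dot l1 (cross x (cross x v) + cross x (cross u y) + cross u (cross x y))|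
  + `|3^-1 * dot l1 (cross x (cross x y))| + `|2^-1 * dot l2 (cross x y)|.

Lemma lagrangian_expansion (l1 l2 u v x y : 'cV[R]_3) k : enorm v = 1 -> `|k| <= 1 ->
  `|lagrangian l1 l2 (u + k *: x) (v + k *: y) - lagrangian l1 l2 u v
    - k * lagrangian_variation l1 l2 u v x y|
  <= lagrangian_remainder l1 l2 u v x y * k ^+ 2.
Proof.
move=> v1 k1; have /andP[n0 n1] := enorm_expansion y k v1.
rewrite /lagrangian_remainder.
set A2 := 3^-1 * dot l1 (cross x (cross x v) + _ + _).
set A3 := 3^-1 * dot l1 (cross x (cross x y)).
set B2 := 2^-1 * dot l2 (cross x y).
set N := enorm (v + k *: y) - 1 - k * dot v y in n0 n1.
have -> : lagrangian l1 l2 (u + k *: x) (v + k *: y) - lagrangian l1 l2 u v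
    - k * lagrangian_variation l1 l2 u v x y =
    N + A2 * k ^+ 2 + k * A3 * k ^+ 2 + B2 * k ^+ 2.
  by rewrite /lagrangian /lagrangian_variation v1 /N /A2 /A3 /B2; coordinates.
rewrite !mulrDl; apply: (le_trans (ler_normD _ _)); apply: lerD; last first.
  by rewrite normrM (ger0_norm (sqr_ge0 k)).
apply: (le_trans (ler_normD _ _)); apply: lerD; last first.
  rewrite normrM (ger0_norm (sqr_ge0 k)) ler_wpM2r ?sqr_ge0// normrM.
  by rewrite ler_piMl.
apply: (le_trans (ler_normD _ _)); apply: lerD; last first.
  by rewrite normrM (ger0_norm (sqr_ge0 k)).
by rewrite ger0_norm// mulrC.
Qed.

(** The momentum: the derivative of the Lagrangian with respect to the velocity,
    at a unit velocity [v], applied to [x]. *)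
Definition boundary_term (l1 l2 u v x : 'cV[R]_3) : R :=
  dot v x + 3^-1 * dot l1 (cross u (cross u x)) + 2^-1 * dot l2 (cross u x).

(** Time derivative of [boundary_term] when [u], [v], [x] have derivatives [v],
    [a], [y]. *)
Definition boundary_derivative (l1 l2 u v a x y : 'cV[R]_3) : R :=
  (dot a x + dot v y)
  + 3^-1 * dot l1 (cross v (cross u x) + cross u (cross v x + cross u y))
  + 2^-1 * dot l2 (cross v x + cross u y).

Definition euler_lagrange (l1 l2 u v a : 'cV[R]_3) : 'cV[R]_3 :=
  cross v (cross l1 u + l2) - a.

(** The pointwise form of the integration by parts. *)
Lemma lagrangian_variation_by_parts (l1 l2 u v a x y : 'cV[R]_3) :
  lagrangian_variation l1 l2 u v x y =
  dot (euler_lagrange l1 l2 u v a) x + boundary_derivative l1 l2 u v a x y.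
Proof.
by rewrite /lagrangian_variation /euler_lagrange /boundary_derivative; coordinates; field.
Qed.

(** * Multipliers compatible with the monodromy *)

Definition monodromy_invariant Q b (l1 l2 : 'cV[R]_3) : Prop :=
  [/\ Q *m b = b, Q *m l1 = l1, Q *m l2 = l2 & cross l1 b = 0].

(** The translation part of the motion enters only through [cross l1 b], which
    vanishes. *)
Lemma euler_lagrange_equivariant Q b (l1 l2 u v a : 'cV[R]_3) : SO3 Q ->
  monodromy_invariant Q b l1 l2 ->
  euler_lagrange l1 l2 (Q *m u + b) (Q *m v) (Q *m a) =
  Q *m euler_lagrange l1 l2 u v a.
Proof.
move=> QSO [Qb Ql1 Ql2 l1b].
rewrite /euler_lagrange mulmxBr -cross_mulmx// mulmxDr -cross_mulmx// Ql1 Ql2.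
by rewrite (crossDr l1) l1b addr0.
Qed.

(** The momentum is not periodic; the right-hand side is the increment that the
    correction terms of the area and of the volume have to cancel.  Since [b] is
    fixed, [Q] factors out of every product and the multipliers absorb it.  Among
    the terms left, those of the form [dot l1 (cross b w)] vanish because [l1] is
    parallel to [b], and the Jacobi identity puts the others in the stated form. *)
Lemma boundary_term_monodromy Q b (l1 l2 u v x : 'cV[R]_3) : SO3 Q ->
  monodromy_invariant Q b l1 l2 ->
  boundary_term l1 l2 (Q *m u + b) (Q *m v) (Q *m x) - boundary_term l1 l2 u v x =
  6^-1 * dot l1 (cross x (cross b u) + cross u (cross b x)) + 2^-1 * dot l2 (cross b x).
Proof.
move=> QSO [Qb Ql1 Ql2 l1b].
have -> : Q *m u + b = Q *m (u + b) by rewrite mulmxDr Qb.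
rewrite /boundary_term !cross_mulmx// dot_mulmx//.
rewrite -[in dot l1 (Q *m _)]Ql1 -[in dot l2 (Q *m _)]Ql2 !dot_mulmx//.
have l1b0 w : dot l1 (cross b w) = 0 by rewrite dot_crossA l1b dot0l.
have jacobi : cross x (cross b u) = cross u (cross b x) - cross b (cross u x) by coordinates.
rewrite jacobi !crossDl !crossDr !dotDr dotNr !l1b0.
by field.
Qed.

(** When [Q] is the identity, only [cross l1 b = 0] has content: then either
    [b = 0] or the axis is the direction of [b].  Otherwise [b] and both
    multipliers lie on the axis. *)
Lemma admissible_monodromy_invariant Q b s (l1 l2 : 'cV[R]_3) : SO3 Q ->
  (Q <> 1%:M -> Q *m b = b) -> (~ id_motion Q b -> screw_direction Q b s) ->
  admissible Q b s l1 l2 -> monodromy_invariant Q b l1 l2.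
Proof.
move=> QSO Qb s_axis [al1 al2].
have [Q1|/eqP Q1] := eqVneq Q 1%:M.
  split; rewrite ?Q1 ?mul1mx//.
  have [->|/eqP b0] := eqVneq b 0; first exact: cross0r.
  have gn : ~ id_motion Q b by move=> [].
  have [_ _ sE] := s_axis gn.
  apply: parallel_cross0 (al1 gn) _; exists (enorm b).
  rewrite sE// scalerA divff ?scale1r//.
  by apply/eqP => /enorm_eq0.
have gn : ~ id_motion Q b by move=> [].
have [s1 /(_ Q1) Qs _] := s_axis gn.
have fixed l : parallel l s -> Q *m l = l by move=> [k ->]; rewrite -scalemxAr Qs.
split; [exact: Qb|exact/fixed/al1|exact/fixed/al2|].
by apply: parallel_cross0 (al1 gn) _; exact: (parallel_axis QSO Q1 s1 Qs (Qb Q1)).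
Qed.

(** The second equation is the rotation of the moment [cross l1 u + l2] under the
    motion.  If [Q] is the identity it reads [cross l1 b = 0]; otherwise [l1] and
    [b] are on the axis, so it reads [Q l2 = l2]. *)
Lemma monodromy_invariant_admissible Q b s (l1 l2 : 'cV[R]_3) : SO3 Q ->
  (Q <> 1%:M -> Q *m b = b) -> (~ id_motion Q b -> screw_direction Q b s) ->
  Q *m l1 = l1 -> cross l1 b + l2 = Q *m l2 -> admissible Q b s l1 l2.
Proof.
move=> QSO Qb s_axis Ql1 Ql2.
have [Q1|/eqP Q1] := eqVneq Q 1%:M.
  split=> // gn; have [_ _ sE] := s_axis gn.
  have b0 : b <> 0 by move=> b0; apply: gn.
  rewrite (sE Q1 b0); apply: parallel_of_cross0 => //.
  by move: Ql2; rewrite Q1 mul1mx => /(canRL (addrK _)); rewrite subrr.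
have gn : ~ id_motion Q b by move=> [].
have [s1 /(_ Q1) Qs _] := s_axis gn.
have l1s := parallel_axis QSO Q1 s1 Qs Ql1.
split=> // _; apply: (parallel_axis QSO Q1 s1 Qs).
have bs := parallel_axis QSO Q1 s1 Qs (Qb Q1).
by rewrite -Ql2 (parallel_cross0 l1s bs) add0r.
Qed.

End vector_algebra.

(** * Derivatives of curves *)

Section calculus.
Set Implicit Arguments.
Unset Strict Implicit.
Variable R : realType.

Lemma is_derive_cVP n (X : R -> 'cV[R]_n) (t : R) dX :
  is_derive t (1 : R) X dX <-> forall i, is_derive t (1 : R) (fun x => X x i 0) (dX i 0).
Proof.
split=> [[dXt <-] i|dXi].
  have /derivable_mxP /(_ i 0) dXit := dXt.
  by apply: DeriveDef => //; rewrite derive_mx// mxE.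
have dXt : derivable X t 1.
  by apply/derivable_mxP => i j; rewrite ord1; exact: ex_derive.
apply: DeriveDef => //; rewrite derive_mx//; apply/colP => i.
by rewrite mxE; exact: derive_val.
Qed.

Section leibniz.
Variables (t : R) (f g : R -> 'cV[R]_3) (df dg : 'cV[R]_3).
Hypotheses (fdf : is_derive t (1 : R) f df) (gdg : is_derive t (1 : R) g dg).

Lemma is_derive_dot :
  is_derive t (1 : R) (fun x => dot (f x) (g x)) (dot df (g t) + dot (f t) dg).
Proof.
have -> : (fun x => dot (f x) (g x)) = \sum_(i < 3) (fun x => f x i 0 * g x i 0).
  by apply/funext => x; rewrite fct_sumE.
apply: is_derive_eq.
  apply: is_derive_sum => i; apply: is_deriveM; exact: (is_derive_cVP _ _ _).1.
by rewrite /dot -big_split; apply: eq_bigr => i _ /=; rewrite /GRing.scale /=; ring.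
Qed.

Lemma is_derive_cross :
  is_derive t (1 : R) (fun x => cross (f x) (g x)) (cross df (g t) + cross (f t) dg).
Proof.
apply/is_derive_cVP => k.
have -> : (fun x => cross (f x) (g x) k 0) =
    (fun x => f x (k + 1) 0) * (fun x => g x (k + 2) 0) -
    (fun x => f x (k + 2) 0) * (fun x => g x (k + 1) 0).
  by apply/funext => x; rewrite mxE.
apply: is_derive_eq.
  by apply: is_deriveB; apply: is_deriveM; exact: (is_derive_cVP _ _ _).1.
by rewrite !mxE /GRing.scale /=; ring.
Qed.

End leibniz.

Lemma is_derive_scale (t : R) (k : R -> R) (X : R -> 'cV[R]_3) dk dX :
  is_derive t (1 : R) k dk -> is_derive t (1 : R) X dX ->
  is_derive t (1 : R) (fun x => k x *: X x) (dk *: X t + k t *: dX).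
Proof.
move=> kdk XdX; apply/is_derive_cVP => i.
have -> : (fun x => (k x *: X x) i 0) = k * (fun x => X x i 0).
  by apply/funext => x; rewrite mxE.
apply: is_derive_eq.
  by apply: is_deriveM; exact: (is_derive_cVP _ _ _).1.
by rewrite !mxE /GRing.scale /=; ring.
Qed.

Lemma is_derive_mulmx (t : R) (Q : 'M[R]_3) (X : R -> 'cV[R]_3) dX :
  is_derive t (1 : R) X dX -> is_derive t (1 : R) (fun x => Q *m X x) (Q *m dX).
Proof.
move=> XdX; apply/is_derive_cVP => i.
have -> : (fun x => (Q *m X x) i 0) = \sum_j Q i j \*: (fun x => X x j 0).
  by apply/funext => x; rewrite mxE fct_sumE.
apply: is_derive_eq.
  by apply: is_derive_sum => j; apply: is_deriveZ; exact: (is_derive_cVP _ _ _).1.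
by rewrite mxE; apply: eq_bigr.
Qed.

Lemma is_derive_translate (V : normedModType R) (c t : R) (X : R -> V) dX :
  is_derive (t + c) (1 : R) X dX -> is_derive t (1 : R) (fun x => X (x + c)) dX.
Proof.
have E : (fun h : R => h^-1 *: (((fun x => X (x + c)) \o shift t) (h *: 1) - X (t + c))) =
         (fun h : R => h^-1 *: ((X \o shift (t + c)) (h *: 1) - X (t + c))).
  by apply/funext => h; rewrite /= addrA.
by move=> [dX1 dX2]; apply: DeriveDef; rewrite /derivable /derive E.
Qed.

Lemma derive1_funE (V : normedModType R) (f df : R -> V) :
  (forall t, is_derive t (1 : R) f (df t)) -> derive1 f = df.
Proof. by move=> fdf; apply/funext => t; rewrite derive1E; exact: derive_val. Qed.

Lemma is_derive_cst_vec (X : R -> 'cV[R]_3) : (forall t, is_derive t (1 : R) X 0) ->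
  forall s t, X s = X t.
Proof.
move=> X0 s t; apply/colP => i.
apply: (@is_derive_0_is_cst _ (fun x => X x i 0)) => x.
by have /is_derive_cVP/(_ i) := X0 x; rewrite mxE.
Qed.

(** A first-order expansion with quadratic remainder determines the derivative.
    It is used for the functionals and for the flatness of a bump function at the
    ends of its support. *)
Lemma is_derive_quadratic (f : R -> R) (t d K : R) :
  (forall h, `|h| <= 1 -> `|f (t + h) - f t - h * d| <= K * h ^+ 2) ->
  is_derive t (1 : R) f d.
Proof.
move=> fK.
have fd : (fun h => h^-1 *: ((f \o shift t) (h *: 1) - f t)) @ 0^' --> (d : R).
  have K1 : 0 < `|K| + 1 by rewrite ltr_pwDr.
  apply/cvgrPdist_le => /= e e0; near=> h.
  have h0 : h != 0 by near: h; exact: nbhs_dnbhs_neq.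
  have h1 : `|h| <= 1 by near: h; exact: dnbhs0_le.
  have he : `|h| <= e / (`|K| + 1) by near: h; apply: dnbhs0_le; rewrite divr_gt0.
  have fh := fK h h1; rewrite [h *: 1]mulr1 [h + t]addrC distrC [_ *: _]/(_ * _).
  rewrite (_ : h^-1 * _ - d = h^-1 * (f (t + h) - f t - h * d)); last by field.
  rewrite normrM normfV ler_pdivrMl ?normr_gt0//.
  apply: (le_trans fh); rewrite -real_normK ?num_real// expr2 mulrA [leRHS]mulrC.
  apply: ler_wpM2r => //.
  move: he; rewrite ler_pdivlMr// => he; apply: le_trans he.
  by rewrite mulrC ler_wpM2l// (le_trans (ler_norm K))// lerDl.
by apply: DeriveDef; [apply/cvg_ex; exists d|exact/cvg_lim].
Unshelve. all: by end_near. Qed.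

End calculus.

(** * Smooth curves *)

Section smoothness.
Set Implicit Arguments.
Unset Strict Implicit.
Variable R : realType.

(** Differentiability [n] times, by recursion through the derivative of [f] and
    not through its derivative of order [n - 1], so that the Leibniz rule can be
    iterated by induction. *)
Fixpoint ndiff (V : normedModType R) n (f : R -> V) : Prop :=
  if n is n'.+1 then (forall t, derivable f t 1) /\ ndiff n' (derive1 f) else True.

Lemma ndiffW (V : normedModType R) n (f : R -> V) : ndiff n.+1 f -> ndiff n f.
Proof. by elim: n f => // n IH f [df /IH]; split. Qed.

Lemma ndiffS (V : normedModType R) n (f df : R -> V) :
  (forall t, is_derive t (1 : R) f (df t)) -> ndiff n df -> ndiff n.+1 f.
Proof. by move=> fdf; rewrite -(derive1_funE fdf); split => // t; exact: ex_derive. Qed.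

Lemma ndiff_is_derive (V : normedModType R) n (f : R -> V) t :
  ndiff n.+1 f -> is_derive t (1 : R) f (derive1 f t).
Proof. by move=> [df _]; rewrite derive1E; apply: derivableP. Qed.

Lemma smooth_ndiff (X : R -> 'cV[R]_3) : smooth X <-> forall n, ndiff n X.
Proof.
split=> [sX n|dX n t].
  elim: n X sX => // n IH X sX; split; first exact: (sX 0%N).
  by apply: IH => k t; rewrite -derive1Sn.
elim: n X dX => [|n IH] X dX; first by case: (dX 1%N).
by rewrite derive1Sn; apply: IH => k; case: (dX k.+1).
Qed.

Lemma ndiffD (V : normedModType R) n (f g : R -> V) : ndiff n f -> ndiff n g ->
  ndiff n (fun t => f t + g t).
Proof.
elim: n f g => // n IH f g df dg.
apply: (ndiffS (df := fun t => derive1 f t + derive1 g t)) => [t|].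
  by apply: is_deriveD; apply: ndiff_is_derive; [exact: df|exact: dg].
by apply: IH; [case: df|case: dg].
Qed.

Lemma ndiff_cst (V : normedModType R) n (c : V) : ndiff n (fun=> c).
Proof.
elim: n c => // n IH c; apply: (ndiffS (df := fun=> 0)).
exact: IH.
Qed.

(** The derivative of a product is a sum of products of functions that are one
    order less differentiable. *)
Lemma ndiff_bilinear (U V W : normedModType R) (B : U -> V -> W) :
  (forall t f g df dg, is_derive t (1 : R) f df -> is_derive t (1 : R) g dg ->
     is_derive t (1 : R) (fun x => B (f x) (g x)) (B df (g t) + B (f t) dg)) ->
  forall n f g, ndiff n f -> ndiff n g -> ndiff n (fun t => B (f t) (g t)).
Proof.
move=> leibniz; elim=> // n IH f g df dg.
apply: (ndiffS (df := fun t => B (derive1 f t) (g t) + B (f t) (derive1 g t))) => [t|].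
  by apply: leibniz; apply: ndiff_is_derive; [exact: df|exact: dg].
apply: ndiffD; apply: IH; try by [case: df|case: dg].
  exact: ndiffW.
exact: ndiffW.
Qed.

Lemma smooth_is_derive n (X : R -> 'cV[R]_3) : smooth X ->
  forall t, is_derive t (1 : R) (derive1n n X) (derive1n n.+1 X t).
Proof. by move=> sX t; rewrite derive1nS derive1E; apply: derivableP; exact: sX. Qed.

Lemma smooth_derive1n n (X : R -> 'cV[R]_3) : smooth X -> smooth (derive1n n X).
Proof.
move=> sX k t; rewrite (_ : derive1n k _ = derive1n (k + n) X); first exact: sX.
by rewrite /derive1n iterD.
Qed.

Lemma smooth_derive1 (X : R -> 'cV[R]_3) : smooth X -> smooth (derive1 X).
Proof. exact: (@smooth_derive1n 1%N). Qed.

Lemma smoothD (X Y : R -> 'cV[R]_3) : smooth X -> smooth Y ->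
  smooth (fun t => X t + Y t).
Proof.
move=> /smooth_ndiff sX /smooth_ndiff sY; apply/smooth_ndiff => n.
exact: ndiffD.
Qed.

Lemma smooth_cst (c : 'cV[R]_3) : smooth (fun=> c).
Proof. by apply/smooth_ndiff => n; exact: ndiff_cst. Qed.

Lemma smooth_cross (X Y : R -> 'cV[R]_3) : smooth X -> smooth Y ->
  smooth (fun t => cross (X t) (Y t)).
Proof.
move=> /smooth_ndiff sX /smooth_ndiff sY; apply/smooth_ndiff => n.
by apply: (ndiff_bilinear (B := @cross R)) => // *; exact: is_derive_cross.
Qed.

Lemma smooth_scale (k : R -> R) (X : R -> 'cV[R]_3) : (forall n, ndiff n k) ->
  smooth X -> smooth (fun t => k t *: X t).
Proof.
move=> sk /smooth_ndiff sX; apply/smooth_ndiff => n.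
apply: (ndiff_bilinear (B := fun (a : R) (v : 'cV[R]_3) => a *: v)) => // *.
exact: is_derive_scale.
Qed.

Lemma is_derive_continuous (V : normedModType R) (f : R -> V) (t : R) df :
  is_derive t (1 : R) f df -> {for t, continuous f}.
Proof.
by move=> [fdf _]; apply/differentiable_continuous/derivable1_diffP.
Qed.

End smoothness.

(** * A smooth bump function *)

Section bump.
Variable R : realType.
Set Implicit Arguments.
Unset Strict Implicit.
Implicit Types (p : {poly R}) (x t : R).

(** The functions [p(1/x) exp(-1/x)], extended by zero, form a family closed under
    derivation; that is why [p] is an arbitrary polynomial. *)
Definition flat p x : R := if 0 < x then p.[x^-1] * expR (- x^-1) else 0.

(** By induction on [p] for all rates [a] at once: half of the rate controls the
    smaller polynomial, the other half controls the additional factor [y]. *)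
Lemma poly_expR_bound p (a : R) : 0 < a ->
  exists C, forall y, 0 <= y -> `|p.[y]| <= C * expR (a * y).
Proof.
elim/poly_ind: p a => [|p c IH] a a0.
  by exists 0 => y _; rewrite horner0 normr0 mul0r.
have a20 : 0 < a / 2 by rewrite divr_gt0.
have [C pC] := IH _ a20; exists (C * (2 / a) + `|c|) => y y0.
rewrite hornerMXaddC (le_trans (ler_normD _ _))// mulrDl lerD//; last first.
  by rewrite ler_peMr// (le_trans _ (expR_ge1Dx _))// lerDl mulr_ge0// ltW.
rewrite normrM (ger0_norm y0).
have -> : a * y = a / 2 * y + a / 2 * y by field.
rewrite expRD mulrACA.
apply: ler_pM => //; first exact: pC.
rewrite -ler_pdivrMl ?divr_gt0// invf_div.
by rewrite (le_trans _ (expR_ge1Dx _))// lerDr.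
Qed.

(** The bound for [p * 'X^2] at [y = 1/x], where the factor [y ^ 2] becomes
    [x ^ -2]. *)
Lemma flat_quadratic p : exists K, forall x, `|flat p x| <= K * x ^+ 2.
Proof.
have [C pC] := poly_expR_bound (p * 'X^2) ltr01; exists C => x.
have C0 : 0 <= C by have := pC 0 (lexx _); rewrite mulr0 expR0 mulr1; exact: le_trans.
rewrite /flat; case: ifPn => [x0|_]; last by rewrite normr0 mulr_ge0// sqr_ge0.
have x0' : x != 0 by rewrite gt_eqF.
have := pC x^-1; rewrite invr_ge0 (ltW x0) => /(_ isT).
rewrite hornerM hornerXn mul1r normrM (ger0_norm (sqr_ge0 _)) => h.
rewrite normrM (ger0_norm (expR_ge0 _)) expRN ler_pdivrMr ?expR_gt0//.
rewrite -[leLHS](mulrK (_ : x ^- 2 \is a GRing.unit)); last first.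
  by rewrite unitfE invr_eq0 expf_eq0.
by rewrite invrK [leRHS]mulrAC ler_wpM2r ?sqr_ge0// -exprVn.
Qed.

Lemma is_derive_flat p t :
  is_derive t (1 : R) (flat p) (flat ('X^2 * (p - p^`())) t).
Proof.
(* Away from 0 the function agrees locally with a formula; at 0 the quadratic
   bound gives the derivative 0. *)
have [t0|t0|->] := ltgtP t 0.
- apply: (near_eq_is_derive (f := cst 0)) => //.
    near=> x; rewrite /flat ltNge (ltW (_ : x < 0))//.
    by near: x; exact: lt_nbhsl.
  by apply: is_derive_eq; rewrite /flat ltNge (ltW t0).
- pose g := (horner p \o GRing.inv) * (expR \o (- GRing.inv)).
  apply: (near_eq_is_derive (f := g)) => //.
    near=> x; rewrite /flat (_ : 0 < x)//.
    by near: x; exact: lt_nbhsr.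
  have tn0 : t != 0 by rewrite gt_eqF.
  have dV : is_derive t (1 : R) GRing.inv (- t ^- 2).
    apply: is_derive_eq; first exact: (is_deriveV (f := id) tn0 (is_derive_id _ _)).
    exact: mulr1.
  have dp : is_derive t (1 : R) (horner p \o GRing.inv) _ :=
    is_derive1_comp (is_derive_poly p t^-1) dV.
  have de : is_derive t (1 : R) (expR \o (- GRing.inv)) _ :=
    is_derive1_comp (g := - GRing.inv) (is_derive_expR (- t^-1)) (is_deriveN dV).
  apply: is_derive_eq (is_deriveM dp de) _.
  rewrite /flat t0 /GRing.scale /= !hornerE !fctE /=.
  by field.
- have [K pK] := flat_quadratic p.
  have flat0 q : flat q 0 = 0 by rewrite /flat ltxx.
  apply: (is_derive_quadratic (K := K)) => h _.
  by rewrite !flat0 add0r mulr0 !subr0.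
Unshelve. all: by end_near. Qed.

Lemma ndiff_flat n p : ndiff n (flat p).
Proof. by elim: n p => // n IH p; apply: ndiffS (is_derive_flat p) (IH _). Qed.

Lemma ndiff_affine n (f : R -> R) a c : (forall k, ndiff k f) ->
  ndiff n (fun t => f (a * t + c)).
Proof.
elim: n f => // n IH f sf.
have dl t : is_derive t (1 : R) (fun x => a * x + c) a.
  rewrite (_ : (fun x => _) = a \*: (@id R) + cst c)//.
  apply: is_derive_eq.
  by rewrite addr0; exact: mulr1.
apply: (ndiffS (df := fun t => derive1 f (a * t + c) * a)).
  move=> t; apply: (is_derive1_comp (f := f)).
  by apply: ndiff_is_derive (sf 1%N).
apply: (ndiff_bilinear (B := fun x y : R => x * y)).
- move=> t u v du dv udu vdv; apply: (is_derive_eq (is_deriveM udu vdv)).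
  by rewrite /GRing.scale /=; ring.
- by apply: IH => k; case: (sf k.+1).
- exact: ndiff_cst.
Qed.

(** Positive exactly on the interval of radius 1 around [c].  The slopes are
    written out to fit [ndiff_affine]. *)
Definition bump (c t : R) : R := flat 1 (1 * t + (1 - c)) * flat 1 (- 1 * t + (1 + c)).

Lemma ndiff_bump n c : ndiff n (bump c).
Proof.
apply: (ndiff_bilinear (B := fun x y : R => x * y)).
- move=> t u v du dv udu vdv; apply: (is_derive_eq (is_deriveM udu vdv)).
  by rewrite /GRing.scale /=; ring.
- by apply: ndiff_affine => k; exact: ndiff_flat.
- by apply: ndiff_affine => k; exact: ndiff_flat.
Qed.

Lemma flat_ge0 t : 0 <= flat 1 t.
Proof. by rewrite /flat; case: ifP => // _; rewrite hornerC mul1r expR_ge0. Qed.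

Lemma bump_ge0 c t : 0 <= bump c t.
Proof. by rewrite mulr_ge0// flat_ge0. Qed.

Lemma bump_center c : 0 < bump c c.
Proof.
have f1 : 0 < flat 1 1 by rewrite /flat ltr01 hornerC mul1r expR_gt0.
by rewrite /bump mul1r mulN1r addrCA subrr addr0 addrCA addNr addr0 mulr_gt0.
Qed.

Lemma bump_support c t : bump c t != 0 -> c - 1 <= t <= c + 1.
Proof.
rewrite /bump mulf_eq0 negb_or /flat => /andP[].
case: ifP => [h1 _|]; last by rewrite eqxx.
case: ifP => [h2 _|]; last by rewrite eqxx.
by apply/andP; split; lra.
Qed.

End bump.

(** * Integrals of continuous functions over a segment *)

Section integrals.
Variable R : realType.
Set Implicit Arguments.
Unset Strict Implicit.
Implicit Types (f g h : R -> R) (a c : R).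

Notation mu := (@lebesgue_measure R).

Lemma continuous_integrable f a c : continuous f -> mu.-integrable `[a, c] (EFin \o f).
Proof.
move=> cf; apply: continuous_compact_integrable; first exact: segment_compact.
exact: continuous_subspaceT.
Qed.
#[local] Hint Resolve continuous_integrable : core.

(** Differentiation under the integral sign: the pointwise quadratic bound is
    integrated. *)
Lemma is_derive_Rintegral (F : R -> R -> R) (F1 G : R -> R) a c :
  (forall e, continuous (F e)) -> continuous F1 -> continuous G ->
  (forall e t, `|e| <= 1 -> `|F e t - F 0 t - e * F1 t| <= G t * e ^+ 2) ->
  is_derive (0 : R) (1 : R) (fun e => \int[mu]_(t in `[a, c]) F e t)
    (\int[mu]_(t in `[a, c]) F1 t).
Proof.
move=> cF cF1 cG FG.
apply: (is_derive_quadratic (K := \int[mu]_(t in `[a, c]) G t)) => e e1.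
rewrite add0r.
have mD : measurable `[a, c]%classic by exact: measurable_itv.
have ceF1 : continuous (fun t => e * F1 t).
  by move=> t; apply: cvgM; [exact: cvg_cst|exact: cF1].
have cB : continuous (fun t => F e t - F 0 t).
  by move=> t; apply: cvgB; exact: cF.
have cBB : continuous (fun t => F e t - F 0 t - e * F1 t).
  by move=> t; apply: cvgB; [exact: cB|exact: ceF1].
rewrite -RintegralB//; [|exact: continuous_integrable..].
rewrite -RintegralZl//; [|exact: continuous_integrable..].
rewrite -RintegralB//; [|exact: continuous_integrable..].
rewrite -RintegralZr//; [|exact: continuous_integrable..].
apply: (le_trans (le_normr_Rintegral _ _)) => //; first exact: continuous_integrable.
apply: le_Rintegral => //.
- by apply: continuous_integrable => t; apply: cvg_norm; exact: cBB.
- apply: continuous_integrable => t; apply: cvgM; first exact: cG.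
  exact: cvg_cst.
- by move=> t _; exact: FG.
Qed.

Lemma Rintegral_derivative (F f : R -> R) a c : a < c -> continuous f ->
  (forall t, is_derive t (1 : R) F (f t)) ->
  \int[mu]_(t in `[a, c]) f t = F c - F a.
Proof.
move=> ac cf Ff.
have cF t : {for t, continuous F} by exact: is_derive_continuous (Ff t).
rewrite /Rintegral (@continuous_FTC2 _ f F)//.
- exact: continuous_subspaceT.
- split.
  + by move=> t _; exact: ex_derive.
  + by apply: cvg_at_right_filter; exact: cF.
  + by apply: cvg_at_left_filter; exact: cF.
- by move=> t _; rewrite derive1E derive_val.
Qed.

(** The primitive from [a] is nondecreasing and vanishes at both ends, so it is
    zero, and so is its derivative [h]; the left end follows by continuity. *)
Lemma Rintegral_eq0_ge0 h a c : continuous h ->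
  (forall t, a <= t <= c -> 0 <= h t) -> \int[mu]_(t in `[a, c]) h t = 0 ->
  forall t, a <= t < c -> h t = 0.
Proof.
move=> ch h0 ih.
have ac_eq0 t : a < t < c -> h t = 0.
  move=> /andP[at_ tc].
  pose G x := \int[mu]_(s in `[a, x]) h s.
  have [dG <-] : derivable G t 1 /\ derive1 G t = h t.
    by apply: (continuous_FTC1_closed tc) => //; [exact: continuous_integrable|exact: ch].
  have G0 x : a <= x <= c -> G x = 0.
    move=> /andP[ax xc]; apply/eqP; rewrite eq_le; apply/andP; split; last first.
      apply: Rintegral_ge0 => s /=; rewrite ?in_itv/= => /andP[as_ sx].
      by apply: h0; rewrite as_ (le_trans sx).
    have : 0 <= G c - G x.
      rewrite /G Rintegral_itvB ?bnd_simp//; last exact: continuous_integrable.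
      apply: Rintegral_ge0 => s /=; rewrite ?in_itv/= => /andP[xs sc].
      by apply: h0; rewrite sc (le_trans ax) ?ltW.
    by rewrite [G c]ih sub0r oppr_ge0.
  have dG0 : is_derive t (1 : R) G 0.
    apply: (near_eq_is_derive (f := cst 0)).
    near=> x; rewrite G0//; apply/andP; split; apply: ltW.
      by near: x; exact: lt_nbhsr.
    by near: x; exact: lt_nbhsl.
  by rewrite derive1E derive_val.
move=> t /andP[]; rewrite le_eqVlt => /orP[/eqP<- ac|at_ tc]; last first.
  by apply: ac_eq0; rewrite at_.
have h1 : h x @[x --> a^'+] --> h a by apply: cvg_at_right_filter; exact: ch.
have h2 : h x @[x --> a^'+] --> (0 : R).
  apply: cvg_near_cst; near=> x.
  apply: ac_eq0; apply/andP; split; near: x; first exact: nbhs_right_gt.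
  exact: nbhs_right_lt.
exact: cvg_unique h1 h2.
Unshelve. all: by end_near. Qed.

End integrals.

(** * First variation of the functionals *)

Section variations.
Variable R : realType.
Set Implicit Arguments.
Unset Strict Implicit.
Implicit Types (X Y gam : R -> 'cV[R]_3) (a c t : R) (l b : 'cV[R]_3).

Notation mu := (@lebesgue_measure R).

Lemma continuous_dot X Y : smooth X -> smooth Y -> continuous (fun t => dot (X t) (Y t)).
Proof.
move=> sX sY t; apply: is_derive_continuous.
exact: is_derive_dot (smooth_is_derive 0%N sX t) (smooth_is_derive 0%N sY t).
Qed.

Lemma continuous_coordinate X i : smooth X -> continuous (fun t => X t i 0).
Proof.
move=> sX t; apply: is_derive_continuous.
exact: (is_derive_cVP _ _ _).1 (smooth_is_derive 0%N sX t) i.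
Qed.

Lemma continuous_enorm X : smooth X -> continuous (fun t => enorm (X t)).
Proof.
move=> sX t.
by apply: (cvg_comp (fun t => dot (X t) (X t)) _ (continuous_dot sX sX (x := t)));
  exact: sqrt_continuous.
Qed.

Let continuousM_cst (k : R) (f : R -> R) : continuous f -> continuous (fun t => k * f t).
Proof. by move=> cf t; apply: cvgM; [exact: cvg_cst|exact: cf]. Qed.

Let continuousD (f g : R -> R) : continuous f -> continuous g ->
  continuous (fun t => f t + g t).
Proof. by move=> cf cg t; apply: cvgD; [exact: cf|exact: cg]. Qed.

Let continuous_abs (f : R -> R) : continuous f -> continuous (fun t => `|f t|).
Proof. by move=> cf t; apply: cvg_norm; exact: cf. Qed.

Lemma smoothZ (k : R) X : smooth X -> smooth (fun t => k *: X t).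
Proof. by move=> sX; apply: smooth_scale => // n; exact: ndiff_cst. Qed.

Ltac smoothness := repeat match goal with
  | H : smooth ?f |- smooth ?f => exact: H
  | |- continuous (fun t => @?f t + @?g t) => apply: (@continuousD f g)
  | |- continuous (fun t => `|@?f t|) => apply: (@continuous_abs f)
  | |- continuous (fun t => ?k * @?f t) => apply: (@continuousM_cst k f)
  | |- continuous (fun t => enorm (@?f t)) => apply: (@continuous_enorm f)
  | |- continuous (fun t => dot (@?f t) (@?g t)) => apply: (@continuous_dot f g)
  | |- smooth (fun=> ?c) => exact: (@smooth_cst R c)
  | |- smooth (fun t => @?f t + @?g t) => apply: (@smoothD R f g)
  | |- smooth (fun t => ?k *: @?f t) => apply: (@smoothZ k f)
  | |- smooth (fun t => cross (@?f t) (@?g t)) => apply: (@smooth_cross R f g)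
  end.

(** The Lagrangian is continuous even where the velocity vanishes, which a varied
    curve may do. *)
Lemma continuous_lagrangian l1 l2 X Y : smooth X -> smooth Y ->
  continuous (fun t => lagrangian l1 l2 (X t) (Y t)).
Proof. by move=> sX sY; rewrite /lagrangian; smoothness. Qed.

Lemma continuous_lagrangian_variation l1 l2 gam V X Y :
  smooth gam -> smooth V -> smooth X -> smooth Y ->
  continuous (fun t => lagrangian_variation l1 l2 (gam t) (V t) (X t) (Y t)).
Proof. by move=> sg sV sX sY; rewrite /lagrangian_variation; smoothness. Qed.

Lemma continuous_lagrangian_remainder l1 l2 gam V X Y :
  smooth gam -> smooth V -> smooth X -> smooth Y ->
  continuous (fun t => lagrangian_remainder l1 l2 (gam t) (V t) (X t) (Y t)).
Proof.
move=> sg sV sX sY; rewrite /lagrangian_remainder; smoothness.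
rewrite (_ : (fun t => _) = (fun t => 2^-1 * dot (Y t) (Y t))); first by smoothness.
by apply/funext => t; rewrite mulrC.
Qed.

Lemma derive1_variation (e : R) gam X : smooth gam -> smooth X ->
  derive1 (fun t => gam t + e *: X t) = (fun t => derive1 gam t + e *: derive1 X t).
Proof.
move=> sg sX; apply: derive1_funE => t.
exact: is_deriveD (smooth_is_derive 0%N sg t) (is_deriveZ e (smooth_is_derive 0%N sX t)).
Qed.

Lemma is_derive_local_functional a c l1 l2 gam X :
  smooth gam -> arclength_parametrized gam -> smooth X ->
  is_derive (0 : R) (1 : R)
    (fun e : R => local_functional a c l1 l2 (fun t => gam t + e *: X t))
    (\int[mu]_(t in `[a, c])
      lagrangian_variation l1 l2 (gam t) (derive1 gam t) (X t) (derive1 X t)).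
Proof.
move=> sg arc sX.
have sg' : smooth (derive1 gam) by exact: smooth_derive1.
have sX' : smooth (derive1 X) by exact: smooth_derive1.
rewrite (_ : (fun e => _) = (fun e : R => \int[mu]_(t in `[a, c])
    lagrangian l1 l2 (gam t + e *: X t) (derive1 gam t + e *: derive1 X t))); last first.
  by apply/funext => e; rewrite /local_functional derive1_variation.
apply: (is_derive_Rintegral
  (F := fun e t => lagrangian l1 l2 (gam t + e *: X t) (derive1 gam t + e *: derive1 X t))
  (G := fun t => lagrangian_remainder l1 l2 (gam t) (derive1 gam t) (X t) (derive1 X t))).
- move=> e; apply: (@continuous_lagrangian l1 l2 (fun t => gam t + e *: X t)
    (fun t => derive1 gam t + e *: derive1 X t)); smoothness.
- exact: (@continuous_lagrangian_variation l1 l2 gam (derive1 gam) X (derive1 X)).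
- exact: (@continuous_lagrangian_remainder l1 l2 gam (derive1 gam) X (derive1 X)).
- by move=> e t e1; rewrite !scale0r !addr0; apply: lagrangian_expansion => //; exact: arc.
Qed.

Definition euler_lagrange_field l1 l2 gam t :=
  euler_lagrange l1 l2 (gam t) (derive1 gam t) (derive1n 2 gam t).

Lemma smooth_euler_lagrange_field l1 l2 gam : smooth gam ->
  smooth (euler_lagrange_field l1 l2 gam).
Proof.
move=> sg; rewrite /euler_lagrange_field /euler_lagrange.
have sg' : smooth (derive1 gam) by exact: smooth_derive1.
have sg2 : smooth (derive1n 2 gam) by exact: smooth_derive1n.
rewrite (_ : (fun t => _) = fun t =>
  cross (derive1 gam t) (cross l1 (gam t) + l2) + (-1) *: derive1n 2 gam t); last first.
  by apply/funext => t; rewrite scaleN1r.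
by smoothness.
Qed.

Definition boundary_value l1 l2 gam X t :=
  boundary_term l1 l2 (gam t) (derive1 gam t) (X t).

(** Integration by parts applied to [is_derive_local_functional]. *)
Lemma first_variation_formula a c l1 l2 gam X : a < c ->
  smooth gam -> arclength_parametrized gam -> smooth X ->
  is_derive (0 : R) (1 : R)
    (fun e : R => local_functional a c l1 l2 (fun t => gam t + e *: X t))
    (\int[mu]_(t in `[a, c]) dot (euler_lagrange_field l1 l2 gam t) (X t)
     + (boundary_value l1 l2 gam X c - boundary_value l1 l2 gam X a)).
Proof.
move=> ac sg arc sX.
have sg' : smooth (derive1 gam) by exact: smooth_derive1.
have sg2 : smooth (derive1n 2 gam) by exact: smooth_derive1n.
have sX' : smooth (derive1 X) by exact: smooth_derive1.
have sE := @smooth_euler_lagrange_field l1 l2 gam sg.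
apply: (is_derive_eq (is_derive_local_functional a c l1 l2 sg arc sX)).
pose dB t := boundary_derivative l1 l2 (gam t) (derive1 gam t) (derive1n 2 gam t)
  (X t) (derive1 X t).
have cdB : continuous dB by rewrite /dB /boundary_derivative; smoothness.
have BdB t : is_derive t (1 : R) (boundary_value l1 l2 gam X) (dB t).
  have dg := smooth_is_derive 0%N sg t.
  have dg' := smooth_is_derive 1%N sg t.
  have dX := smooth_is_derive 0%N sX t.
  have dgX := is_derive_cross dg dX.
  have d1 := is_deriveZ 3^-1 (is_derive_dot (is_derive_cst l1 t (1 : R))
    (is_derive_cross dg dgX)).
  have d2 := is_deriveZ 2^-1 (is_derive_dot (is_derive_cst l2 t (1 : R)) dgX).
  apply: (is_derive_eq (is_deriveD (is_deriveD (is_derive_dot dg' dX) d1) d2)).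
  by rewrite !dot0l !add0r.
rewrite -(Rintegral_derivative ac cdB BdB) -RintegralD//; last 2 first.
- by apply: continuous_integrable; exact: continuous_dot.
- exact: continuous_integrable.
by apply: eq_Rintegral => t _; exact: lagrangian_variation_by_parts.
Qed.

Lemma dot_Rintegral a c l Y : smooth Y ->
  dot l (\col_i \int[mu]_(t in `[a, c]) Y t i 0) = \int[mu]_(t in `[a, c]) dot l (Y t).
Proof.
move=> sY; under [RHS]eq_Rintegral do rewrite dot3E.
have cY i : continuous (fun t => l i 0 * Y t i 0).
  by apply: continuousM_cst; exact: continuous_coordinate.
rewrite RintegralD//; last 2 first.
- by apply: continuous_integrable; apply: continuousD.
- exact: continuous_integrable.
rewrite RintegralD//; [|exact: continuous_integrable..].
by rewrite dot3E !mxE !RintegralZl//;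
  apply: continuous_integrable; exact: continuous_coordinate.
Qed.

(** The terms at the base point in the area and volume functionals, paired with
    the multipliers. *)
Definition translation_correction b l1 l2 (u : 'cV[R]_3) : R :=
  - (6^-1 * dot l1 (cross u (cross b u)) + 2^-1 * dot l2 (cross b u)).

(** It holds at a zero of the speed too, since the derivative is zero there.  So
    area and volume are integrals of expressions linear in the velocity, also for
    varied curves that are not immersed. *)
Lemma arclength_derivativeK gam t :
  speed gam t *: arclength_derivative gam t = derive1 gam t.
Proof.
rewrite /arclength_derivative /speed; have [n0|n0] := eqVneq (enorm (derive1 gam t)) 0.
  by rewrite n0 scale0r (enorm_eq0 n0).
by rewrite scalerA divff// scale1r.
Qed.

(** The total functional is the local one over the fundamental domain, up to
    the correction at the base point. *)
Lemma total_functionalE T0 t0 b l1 l2 gam : smooth gam ->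
  total_functional T0 t0 b l1 l2 gam =
  local_functional t0 (t0 + T0) l1 l2 gam + translation_correction b l1 l2 (gam t0).
Proof.
move=> sg; have sg' : smooth (derive1 gam) by exact: smooth_derive1.
have areaE : arclength_integral gam t0 (t0 + T0)
    (fun t => cross (gam t) (arclength_derivative gam t)) =
    \col_i \int[mu]_(t in `[t0, t0 + T0]) cross (gam t) (derive1 gam t) i 0.
  apply/colP => i; rewrite !mxE; apply: eq_Rintegral => t _.
  by rewrite -arclength_derivativeK crossZr [in RHS]mxE mulrC.
have volumeE : arclength_integral gam t0 (t0 + T0)
    (fun t => cross (gam t) (cross (gam t) (arclength_derivative gam t))) =
    \col_i \int[mu]_(t in `[t0, t0 + T0])
      cross (gam t) (cross (gam t) (derive1 gam t)) i 0.
  apply/colP => i; rewrite !mxE; apply: eq_Rintegral => t _.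
  by rewrite -arclength_derivativeK !crossZr [in RHS]mxE mulrC.
rewrite /total_functional /volume_functional /area_functional areaE volumeE.
rewrite !dotDr !dotNr !dotZr.
rewrite (@dot_Rintegral t0 (t0 + T0) l1
  (fun t => cross (gam t) (cross (gam t) (derive1 gam t)))); last by smoothness.
rewrite (@dot_Rintegral t0 (t0 + T0) l2 (fun t => cross (gam t) (derive1 gam t)));
  last by smoothness.
have cv0 : continuous (fun t => dot l1 (cross (gam t) (cross (gam t) (derive1 gam t)))).
  by smoothness.
have ca0 : continuous (fun t => dot l2 (cross (gam t) (derive1 gam t))) by smoothness.
have cv : continuous (fun t => 3^-1 * dot l1 (cross (gam t) (cross (gam t) (derive1 gam t)))).
  by smoothness.
have ca : continuous (fun t => 2^-1 * dot l2 (cross (gam t) (derive1 gam t))) by smoothness.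
have cs : continuous (fun t => enorm (derive1 gam t)) by smoothness.
rewrite /local_functional RintegralD//; last 2 first.
- by apply: continuous_integrable; exact: continuousD.
- exact: continuous_integrable.
rewrite RintegralD//; [|exact: continuous_integrable..].
rewrite !RintegralZl//; [|exact: continuous_integrable..].
by rewrite /length_functional /translation_correction; ring.
Qed.

Lemma is_derive_translation_correction b l1 l2 (u x : 'cV[R]_3) :
  is_derive (0 : R) (1 : R) (fun e : R => translation_correction b l1 l2 (u + e *: x))
    (- (6^-1 * dot l1 (cross x (cross b u) + cross u (cross b x))
        + 2^-1 * dot l2 (cross b x))).
Proof.
have du : is_derive (0 : R) (1 : R) (fun e : R => u + e *: x) x.
  have := is_deriveD (is_derive_cst u (0 : R) (1 : R))
    (is_derive_scale (is_derive_id (0 : R) (1 : R)) (is_derive_cst x (0 : R) (1 : R))).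
  by rewrite scaler0 scale1r addr0 add0r.
have dbu := is_derive_cross (is_derive_cst b (0 : R) (1 : R)) du.
have d1 := is_deriveZ 6^-1
  (is_derive_dot (is_derive_cst l1 (0 : R) (1 : R)) (is_derive_cross du dbu)).
have d2 := is_deriveZ 2^-1 (is_derive_dot (is_derive_cst l2 (0 : R) (1 : R)) dbu).
apply: (is_derive_eq (is_deriveN (is_deriveD d1 d2))).
by rewrite !dot0l !cross0l !add0r !scale0r !addr0.
Qed.

Lemma derive1_monodromy c (Q : 'M[R]_3) b X : smooth X ->
  (forall t, X (t + c) = Q *m X t + b) ->
  forall t, derive1 X (t + c) = Q *m derive1 X t.
Proof.
move=> sX XQ t.
have d1 := is_derive_translate (smooth_is_derive 0%N sX (t + c)).
have d2 := is_deriveD (is_derive_mulmx Q (smooth_is_derive 0%N sX t))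
  (is_derive_cst b t (1 : R)).
rewrite addr0 in d2.
rewrite (_ : (fun x => X (x + c)) = (fun x => Q *m X x + b)) in d1; last exact/funext.
by case: d1 => _ h1; case: d2 => _ h2; exact: etrans (esym h1) h2.
Qed.

(** The translation [b] disappears after one derivative, so the induction applies
    to the derivative with [b = 0]. *)
Lemma derive1n_monodromy n c (Q : 'M[R]_3) b X : smooth X ->
  (forall t, X (t + c) = Q *m X t + b) ->
  forall t, derive1n n.+1 X (t + c) = Q *m derive1n n.+1 X t.
Proof.
move=> sX; elim: n X b sX => [|n IH] X b sX XQ t; first exact: derive1_monodromy XQ t.
rewrite (derive1Sn X n.+1); apply: (IH _ 0); first exact: smooth_derive1.
by move=> s; rewrite addr0; exact: derive1_monodromy XQ s.
Qed.

(** The increment of the momentum over the fundamental domain is cancelled by the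
    derivative of the correction terms. *)
Lemma total_variation_formula T0 t0 Q b l1 l2 gam X : 0 < T0 -> SO3 Q ->
  monodromy_invariant Q b l1 l2 -> quasi_periodic T0 Q b gam ->
  arclength_parametrized gam -> tangent_space T0 Q X ->
  is_derive (0 : R) (1 : R)
    (fun e : R => total_functional T0 t0 b l1 l2 (fun t => gam t + e *: X t))
    (\int[mu]_(t in `[t0, t0 + T0]) dot (euler_lagrange_field l1 l2 gam t) (X t)).
Proof.
move=> T00 QSO inv [sg _ gT] arc [sX XT].
have ac : t0 < t0 + T0 by rewrite ltrDl.
rewrite (_ : (fun e => _) = (fun e : R =>
    local_functional t0 (t0 + T0) l1 l2 (fun t => gam t + e *: X t)
    + translation_correction b l1 l2 (gam t0 + e *: X t0))); last first.
  apply/funext => e.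
  have sgX : smooth (fun t => gam t + e *: X t) by smoothness.
  exact: (@total_functionalE T0 t0 b l1 l2 _ sgX).
apply: (is_derive_eq (is_deriveD (first_variation_formula l1 l2 ac sg arc sX)
  (is_derive_translation_correction b l1 l2 (gam t0) (X t0)))).
have g'T : derive1 gam (t0 + T0) = Q *m derive1 gam t0.
  by rewrite (derive1_monodromy sg gT).
rewrite /boundary_value gT XT g'T boundary_term_monodromy//.
by rewrite addrK.
Qed.

End variations.

(** * Stationarity and the Euler-Lagrange equation *)

Section critical_points.
Variable R : realType.
Set Implicit Arguments.
Unset Strict Implicit.
Implicit Types (X gam : R -> 'cV[R]_3) (a c t : R) (l b : 'cV[R]_3) (Q : 'M[R]_3).

Notation mu := (@lebesgue_measure R).

(** Every point is moved into the fundamental domain by a multiple of the period,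
    and [Q] is injective. *)
Lemma equivariant_eq0 T0 t0 Q X : 0 < T0 -> SO3 Q ->
  (forall t, X (t + T0) = Q *m X t) -> (forall t, t0 <= t < t0 + T0 -> X t = 0) ->
  forall t, X t = 0.
Proof.
move=> T00 QSO XT X0.
have shift n t : X (t + n%:R * T0) = 0 <-> X t = 0.
  elim: n => [|n IH]; first by rewrite mul0r addr0.
  rewrite -IH -natr1 mulrDl mul1r (addrA t) XT; split=> [|->]; last exact: mulmx0.
  by move=> QE; apply: dot_eq0; rewrite -(dot_mulmx _ _ QSO) QE dot0l.
move=> t; pose z := Num.floor ((t - t0) / T0).
have : X (t - z%:~R * T0) = 0.
  apply: X0; have := floor_itv ((t - t0) / T0); rewrite -/z.
  rewrite ler_pdivlMr// ltr_pdivrMr// intrD mulrDl mul1r => /andP[h1 h2].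
  by apply/andP; split; lra.
case: z => n.
  by move=> h; rewrite -(subrK (n%:R * T0) t); apply/shift.
by rewrite NegzE mulrNz mulNr opprK => /shift.
Qed.

Lemma Rintegral_dot0 a c (E X : R -> 'cV[R]_3) : (forall t, E t = 0) ->
  \int[mu]_(t in `[a, c]) dot (E t) (X t) = 0.
Proof.
move=> E0; under eq_Rintegral do rewrite E0 dot0l.
by rewrite Rintegral_cst ?mul0r.
Qed.

(** The field [E] is equivariant, hence it is itself a tangent vector; the
    variation in its direction is the integral of its squared norm. *)
Lemma stationary_euler_lagrange T0 t0 Q b l1 l2 gam : 0 < T0 -> SO3 Q ->
  monodromy_invariant Q b l1 l2 -> quasi_periodic T0 Q b gam ->
  arclength_parametrized gam ->
  stationary T0 t0 Q b l1 l2 gam <-> forall t, euler_lagrange_field l1 l2 gam t = 0.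
Proof.
move=> T00 QSO inv qp arc; have [sg _ gT] := qp.
have sE := @smooth_euler_lagrange_field R l1 l2 gam sg.
set E := euler_lagrange_field l1 l2 gam in sE *.
have ET t : E (t + T0) = Q *m E t.
  rewrite /E /euler_lagrange_field gT (derive1_monodromy sg gT) (derive1n_monodromy _ sg gT).
  exact: euler_lagrange_equivariant.
split=> [st|E0 X tX].
- have intE : \int[mu]_(t in `[t0, t0 + T0]) dot (E t) (E t) = 0.
    have tE : tangent_space T0 Q E by split.
    have [_ <-] := total_variation_formula t0 T00 QSO inv qp arc tE.
    by have [_ ->] := st E tE.
  have cEE : continuous (fun t => dot (E t) (E t)) by exact: continuous_dot.
  have E0 t : t0 <= t < t0 + T0 -> E t = 0.
    move=> tt; apply: dot_eq0.
    by apply: (Rintegral_eq0_ge0 cEE _ intE tt) => s _; exact: dot_ge0.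
  exact: (equivariant_eq0 T00 QSO ET E0).
- apply: (is_derive_eq (total_variation_formula t0 T00 QSO inv qp arc tX)).
  exact: Rintegral_dot0.
Qed.

Lemma boundary_value0 l1 l2 gam X t : X t = 0 -> boundary_value l1 l2 gam X t = 0.
Proof.
by move=> X0; rewrite /boundary_value /boundary_term X0 !(cross0r, dot0r, mulr0, addr0).
Qed.

(** At a point [t], the test variation is the field times a bump function centered
    at [t]. *)
Lemma locally_stationary_euler_lagrange l1 l2 gam : smooth gam ->
  arclength_parametrized gam ->
  locally_stationary l1 l2 gam <-> forall t, euler_lagrange_field l1 l2 gam t = 0.
Proof.
move=> sg arc.
have sE := @smooth_euler_lagrange_field R l1 l2 gam sg.
set E := euler_lagrange_field l1 l2 gam in sE *.
(* At the ends of the interval, and everywhere if it is empty, [X] is zero. *)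
have X0 X (A : set R) t : supp X `<=` A -> ~ A t -> X t = 0.
  move=> XA At; apply/eqP; apply: contra_notT At => Xt.
  by apply: XA; exact: subset_closure.
split=> [st t|E0 X sX _ a c Xac].
- pose X s := bump t s *: E s.
  have sX : smooth X by apply: smooth_scale => // n; exact: ndiff_bump.
  have Xt : supp X `<=` `[t - 1, t + 1].
    have cI : closed `[t - 1, t + 1]%classic by exact: interval_closed.
    rewrite /supp [X in _ `<=` X](closure_id _).1//; apply: closureS => s /= Xs.
    rewrite in_itv/=; apply: bump_support; apply: contra_neq Xs.
    by rewrite /X => ->; rewrite scale0r.
  have cX : compact (supp X).
    apply: (subclosed_compact _ _ Xt); first exact: closed_closure.
    exact: segment_compact.
  have Xac : supp X `<=` `]t - 2, t + 2[.
    move=> s /Xt /=; rewrite !in_itv/= => /andP[h1 h2].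
    by apply/andP; split; lra.
  have ac : t - 2 < t + 2 by lra.
  have intE : \int[mu]_(s in `[t - 2, t + 2]) (bump t s * dot (E s) (E s)) = 0.
    have [_ <-] := st X sX cX _ _ Xac.
    have [_ ->] := first_variation_formula l1 l2 ac sg arc sX.
    rewrite !boundary_value0 ?subrr ?addr0; last 2 first.
    + by apply: (X0 _ _ _ Xac); rewrite /= in_itv/= ltxx.
    + by apply: (X0 _ _ _ Xac); rewrite /= in_itv/= ltxx andbF.
    by apply: eq_Rintegral => s _; rewrite dotZr.
  have cEE : continuous (fun s => bump t s * dot (E s) (E s)).
    move=> s; apply: cvgM; last exact: continuous_dot.
    by apply: is_derive_continuous; apply: ndiff_is_derive (ndiff_bump 1 t).
  apply: dot_eq0.
  have tt : t - 2 <= t < t + 2 by apply/andP; split; lra.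
  have /eqP := Rintegral_eq0_ge0 cEE
    (fun s _ => mulr_ge0 (bump_ge0 t s) (dot_ge0 (E s))) intE tt.
  by rewrite mulf_eq0 gt_eqF ?bump_center//= => /eqP.
- have [ac|ca] := ltP a c.
  + apply: (is_derive_eq (first_variation_formula l1 l2 ac sg arc sX)).
    rewrite !boundary_value0 ?subrr ?addr0; last 2 first.
    * by apply: (X0 _ _ _ Xac); rewrite /= in_itv/= ltxx.
    * by apply: (X0 _ _ _ Xac); rewrite /= in_itv/= ltxx andbF.
    exact: Rintegral_dot0.
  + rewrite (_ : (fun e => _) = cst (local_functional a c l1 l2 gam)).
      exact: is_derive_cst.
    apply/funext => e; congr (local_functional _ _ _ _ _); apply/funext => t.
    rewrite (X0 _ _ t Xac) ?scaler0 ?addr0//= in_itv/= => /andP[h1 h2].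
    by have := lt_trans h1 h2; rewrite ltNge ca.
Qed.

End critical_points.

(** * Elastic curves and Kirchhoff's equations *)

Section elastic_curves.
Variable R : realType.
Set Implicit Arguments.
Unset Strict Implicit.
Implicit Types (gam : R -> 'cV[R]_3) (a m t : R).

(** Left-hand side of the elastic equation; [v], [v1], [v2], [v3] stand for the
    unit tangent and its derivatives. *)
Definition elastic_residual a m (v v1 v2 v3 : 'cV[R]_3) : 'cV[R]_3 :=
  v3 + (3 / 2 * dot v1 v1) *: v1 - dot v3 v *: v - a *: v1 - m *: cross v v2.

(** A primitive of the elastic equation along a curve of unit speed; in the rod
    model it is the internal force, constant in equilibrium. *)
Definition elastic_force a m (v v1 v2 : 'cV[R]_3) : 'cV[R]_3 :=
  v2 + (3 / 2 * dot v1 v1) *: v - a *: v - m *: cross v v1.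

(** The internal moment of the rod, a twisting part along the tangent and a bending
    part; with this sign it is [cross l1 gam + l2] in equilibrium. *)
Definition elastic_moment m (v v1 : 'cV[R]_3) : 'cV[R]_3 := - (m *: v) - cross v v1.

Section unit_speed.
Variables gam T T1 T2 T3 : R -> 'cV[R]_3.
Hypotheses (dg : forall t, is_derive t (1 : R) gam (T t))
  (dT : forall t, is_derive t (1 : R) T (T1 t))
  (dT1 : forall t, is_derive t (1 : R) T1 (T2 t))
  (dT2 : forall t, is_derive t (1 : R) T2 (T3 t)).
Hypothesis unit_tangent : forall t, dot (T t) (T t) = 1.

Let is_derive_eq_cst (f : R -> R) (c : R) t df :
  (forall s, f s = c) -> is_derive t (1 : R) f df -> df = 0.
Proof.
move=> fc; rewrite (_ : f = cst c); last exact/funext.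
by move=> [_ <-]; exact: derive_cst.
Qed.

Lemma tangent_orth t : dot (T t) (T1 t) = 0.
Proof.
have := is_derive_eq_cst unit_tangent (is_derive_dot (dT t) (dT t)).
by rewrite dotC => h; lra.
Qed.

Lemma tangent_second t : dot (T t) (T2 t) = - dot (T1 t) (T1 t).
Proof.
have := is_derive_eq_cst tangent_orth (is_derive_dot (dT t) (dT1 t)).
by move=> h; lra.
Qed.

Lemma tangent_third t : dot (T t) (T3 t) = - 3 * dot (T1 t) (T2 t).
Proof.
have e s : dot (T s) (T2 s) + dot (T1 s) (T1 s) = 0 by rewrite tangent_second addNr.
have := is_derive_eq_cst e (is_deriveD (is_derive_dot (dT t) (dT2 t))
  (is_derive_dot (dT1 t) (dT1 t))).
by rewrite (dotC (T2 t) (T1 t)) => h; lra.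
Qed.

(** The two scalar terms combine because [dot (T t) (T3 t)] is
    [- 3 * dot (T1 t) (T2 t)]. *)
Lemma is_derive_elastic_force a m t :
  is_derive t (1 : R) (fun t => elastic_force a m (T t) (T1 t) (T2 t))
    (elastic_residual a m (T t) (T1 t) (T2 t) (T3 t)).
Proof.
have dk := is_deriveZ (3 / 2) (is_derive_dot (dT1 t) (dT1 t)).
have d1 := is_derive_scale dk (dT t).
have d2 := is_deriveZ a (dT t).
have d3 := is_deriveZ m (is_derive_cross (dT t) (dT1 t)).
apply: (is_derive_eq (is_deriveB (is_deriveB (is_deriveD (dT2 t) d1) d2) d3)).
rewrite /elastic_residual crossvv add0r.
rewrite (dotC (T3 t)) tangent_third (dotC (T2 t)) /GRing.scale /=.
do 2!congr (_ - _); rewrite -!addrA; congr (_ + _).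
rewrite addrC; congr (_ + _); rewrite -scaleNr; congr (_ *: _).
by field.
Qed.

Lemma is_derive_elastic_moment m t :
  is_derive t (1 : R) (fun t => elastic_moment m (T t) (T1 t))
    (- (m *: T1 t) - cross (T t) (T2 t)).
Proof.
apply: (is_derive_eq (is_deriveB (is_deriveN (is_deriveZ m (dT t)))
  (is_derive_cross (dT t) (dT1 t)))).
by rewrite crossvv add0r.
Qed.

(** Balance of moments: with [is_derive_elastic_moment], the moment changes at the
    rate [cross force T]. *)
Lemma cross_elastic_force a m t :
  cross (elastic_force a m (T t) (T1 t) (T2 t)) (T t) = - (m *: T1 t) - cross (T t) (T2 t).
Proof.
rewrite /elastic_force !(crossDl, crossNl, crossZl) crossvv !scaler0.
rewrite subr0 addr0 (crossC (T2 t)) (crossC (cross _ _)) cross_cross.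
rewrite tangent_orth unit_tangent scale0r scale1r sub0r opprK.
by rewrite addrC.
Qed.

(** Force balance gives [l1], and moment balance then makes
    [moment - cross l1 gam] a constant [l2].  The Euler-Lagrange equation is the
    identity [cross T moment = T']. *)
Lemma elastic_euler_lagrange a m :
  (forall t, elastic_residual a m (T t) (T1 t) (T2 t) (T3 t) = 0) ->
  exists l1 l2 : 'cV[R]_3, [/\ forall t, elastic_force a m (T t) (T1 t) (T2 t) = l1,
    forall t, elastic_moment m (T t) (T1 t) = cross l1 (gam t) + l2 &
    forall t, euler_lagrange l1 l2 (gam t) (T t) (T1 t) = 0].
Proof.
move=> res0; pose l1 := elastic_force a m (T 0) (T1 0) (T2 0).
have forceE t : elastic_force a m (T t) (T1 t) (T2 t) = l1.
  apply: (is_derive_cst_vec (X := fun t => elastic_force a m (T t) (T1 t) (T2 t))) => s.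
  rewrite -(res0 s).
  exact: is_derive_elastic_force.
pose l2 := elastic_moment m (T 0) (T1 0) - cross l1 (gam 0).
have momentE t : elastic_moment m (T t) (T1 t) = cross l1 (gam t) + l2.
  rewrite addrC; apply/eqP; rewrite -subr_eq; apply/eqP.
  apply: (is_derive_cst_vec
    (X := fun t => elastic_moment m (T t) (T1 t) - cross l1 (gam t))) => s.
  apply: (is_derive_eq (is_deriveB (is_derive_elastic_moment m s)
    (is_derive_cross (is_derive_cst l1 s (1 : R)) (dg s)))).
  by rewrite cross0l add0r -(forceE s) cross_elastic_force subrr.
exists l1, l2; split=> // t.
rewrite /euler_lagrange -momentE /elastic_moment.
rewrite crossDr !crossNr crossZr crossvv scaler0 oppr0 add0r.
by rewrite cross_cross tangent_orth unit_tangent scale0r scale1r sub0r opprK subrr.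
Qed.

(** The conserved quantities [mu = dot T W] and
    [c = dot W W - 2 * dot T l1], where [W = cross l1 gam + l2], fix the constants
    [a = (c - mu ^+ 2) / 2] and [m = - mu]; with them the force is [l1], and its
    derivative, the elastic equation, vanishes. *)
Lemma euler_lagrange_elastic (l1 l2 : 'cV[R]_3) :
  (forall t, euler_lagrange l1 l2 (gam t) (T t) (T1 t) = 0) ->
  exists a m, forall t, elastic_residual a m (T t) (T1 t) (T2 t) (T3 t) = 0.
Proof.
move=> EL.
have [W [T1E dW]] : exists W : R -> 'cV[R]_3, (forall t, T1 t = cross (T t) (W t)) /\
    (forall t, is_derive t (1 : R) W (cross l1 (T t))).
  exists (fun t => cross l1 (gam t) + l2); split=> t.
    by apply/esym/subr0_eq; exact: EL.
  apply: (is_derive_eq (is_deriveD (is_derive_cross (is_derive_cst l1 t (1 : R)) (dg t))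
    (is_derive_cst l2 t (1 : R)))).
  by rewrite cross0l add0r addr0.
have T2E t : T2 t = cross (T1 t) (W t) + cross (T t) (cross l1 (T t)).
  have d := is_derive_cross (dT t) (dW t).
  rewrite (_ : (fun x => cross (T x) (W x)) = T1) in d; last exact/esym/funext.
  by case: (dT1 t) => _ h1; case: d => _ h2; exact: etrans (esym h1) h2.
have muE t : dot (T t) (W t) = dot (T 0) (W 0).
  apply: (@is_derive_0_is_cst _ (fun t => dot (T t) (W t))) => s.
  apply: (is_derive_eq (is_derive_dot (dT s) (dW s))).
  by rewrite T1E dot_crossr addr0 dotC dot_crossr.
have cE t : dot (W t) (W t) - 2 * dot (T t) l1 = dot (W 0) (W 0) - 2 * dot (T 0) l1.
  apply: (@is_derive_0_is_cst _ (fun t => dot (W t) (W t) - 2 * dot (T t) l1)) => s.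
  apply: (is_derive_eq (is_deriveB (is_derive_dot (dW s) (dW s))
    (is_deriveZ 2 (is_derive_dot (dT s) (is_derive_cst l1 s (1 : R)))))).
  have e : dot (cross l1 (T s)) (W s) = dot (cross (T s) (W s)) l1.
    by rewrite [RHS]dotC dot_crossA.
  rewrite T1E dot0r addr0 (dotC (W s)) e.
  by apply/eqP; rewrite subr_eq0 eq_sym; apply/eqP; exact: mulr_natl.
set mu := dot (T 0) (W 0) in muE.
set c := (dot (W 0) (W 0) - _) in cE.
exists ((c - mu ^+ 2) / 2), (- mu) => t.
have forceE s : elastic_force ((c - mu ^+ 2) / 2) (- mu) (T s) (T1 s) (T2 s) = l1.
  (* The component of [W] along [T] is [mu], the normal one is [- T x T']. *)
  have WE : W s = mu *: T s - cross (T s) (T1 s).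
    rewrite T1E cross_cross muE unit_tangent scale1r.
    by rewrite opprB addrC subrK.
  have T11 : dot (T1 s) (T1 s) = dot (W s) (W s) - mu ^+ 2.
    by rewrite [in LHS]T1E lagrange_identity unit_tangent mul1r muE.
  have T2' : T2 s = - (mu *: cross (T s) (T1 s)) - dot (T1 s) (T1 s) *: T s
      + (l1 - dot (T s) l1 *: T s).
    rewrite T2E [W s]WE crossDr crossNr crossZr !cross_cross unit_tangent scale1r.
    rewrite (dotC (T1 s) (T s)) tangent_orth scale0r subr0 (crossC (T1 s) (T s)) scalerN.
    by [].
  have aE : (c - mu ^+ 2) / 2 = dot (T1 s) (T1 s) / 2 - dot (T s) l1.
    by rewrite -(cE s) T11; field.
  have collect (X v l : 'cV[R]_3) (k p n : R) :
      - (n *: X) - k *: v + (l - p *: v) + (3 / 2 * k) *: v - (k / 2 - p) *: v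
      - (- n) *: X = l.
    by apply/colP => i; rewrite !mxE; field.
  by rewrite /elastic_force aE T2' collect.
have := is_derive_elastic_force ((c - mu ^+ 2) / 2) (- mu) t.
rewrite (_ : (fun t => _) = cst l1); last exact/funext.
by move=> [_ <-]; exact: derive_cst.
Qed.

End unit_speed.

End elastic_curves.

(** * The equivalence *)

Section equivalence.
Set Implicit Arguments.
Unset Strict Implicit.

(** For the multipliers built from an elastic curve, admissibility comes from
    comparing force and moment at [0] and at [T0]: both are rotated by [Q]. *)
Lemma elastic_iff_euler_lagrange (R : realType) (T0 : R) (Q : 'M[R]_3) (b s : 'cV[R]_3)
    (gam : R -> 'cV[R]_3) :
  SO3 Q -> (Q <> 1%:M -> Q *m b = b) ->
  (~ id_motion Q b -> screw_direction Q b s) ->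
  quasi_periodic T0 Q b gam -> arclength_parametrized gam ->
  elastic gam <->
  exists lambda1 lambda2 : 'cV[R]_3, admissible Q b s lambda1 lambda2 /\
    forall t, euler_lagrange_field lambda1 lambda2 gam t = 0.
Proof.
move=> QSO Qb s_axis [sg _ gT] arc.
have dn n t := smooth_is_derive n sg t.
have unit t : dot (derive1n 1 gam t) (derive1n 1 gam t) = 1.
  by rewrite -enorm_sqr -[RHS](expr1n _ 2) -(arc t).
split=> [[a [m res0]]|[l1 [l2 [_ EL]]]]; last first.
  have [a [m res0]] := euler_lagrange_elastic (dn 0%N) (dn 1%N) (dn 2%N) (dn 3%N) unit EL.
  by exists a, m => t; exact: res0.
have [l1 [l2 [forceE momentE EL]]] :=
  elastic_euler_lagrange (dn 0%N) (dn 1%N) (dn 2%N) (dn 3%N) unit res0.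
exists l1, l2; split=> //.
have dnT n t := derive1n_monodromy n sg gT t.
have Ql1 : Q *m l1 = l1.
  rewrite -{2}(forceE (0 + T0)) -(forceE 0) !dnT /elastic_force.
  by rewrite !cross_mulmx// !dot_mulmx// !(mulmxDr, mulmxN, scalemxAr).
apply: (monodromy_invariant_admissible QSO Qb s_axis Ql1).
have : elastic_moment m (derive1n 1 gam (0 + T0)) (derive1n 2 gam (0 + T0)) =
    Q *m elastic_moment m (derive1n 1 gam 0) (derive1n 2 gam 0).
  by rewrite !dnT /elastic_moment cross_mulmx// mulmxBr mulmxN scalemxAr.
rewrite (momentE (0 + T0)) (momentE 0) derive1n0 (gT 0).
rewrite mulmxDr -cross_mulmx// Ql1 crossDr -addrA.
exact: addrI.
Qed.

End equivalence.

Theorem theorem2p5 (R : realType) (T0 : R) (Q : 'M[R]_3) (b s : 'cV[R]_3)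
    (gam : R -> 'cV[R]_3) (t0 : R)
    (T0_gt0 : 0 < T0)
    (Q_SO3 : SO3 Q)
    (origin_on_axis : Q <> 1%:M -> Q *m b = b)
    (s_axis : ~ id_motion Q b -> screw_direction Q b s)
    (gam_Mg : quasi_periodic T0 Q b gam)
    (gam_arc : arclength_parametrized gam) :
  (forall lambda1 lambda2 : 'cV[R]_3, admissible Q b s lambda1 lambda2 ->
     (stationary T0 t0 Q b lambda1 lambda2 gam <->
      locally_stationary lambda1 lambda2 gam)) /\
  (elastic gam <->
     exists lambda1 lambda2 : 'cV[R]_3, admissible Q b s lambda1 lambda2 /\
       stationary T0 t0 Q b lambda1 lambda2 gam) /\
  (elastic gam <->
     exists lambda1 lambda2 : 'cV[R]_3, admissible Q b s lambda1 lambda2 /\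
       locally_stationary lambda1 lambda2 gam).
Proof.
have EL_elastic := elastic_iff_euler_lagrange Q_SO3 origin_on_axis s_axis gam_Mg gam_arc.
have [sg _ _] := gam_Mg.
have EL_stat l1 l2 : admissible Q b s l1 l2 ->
    stationary T0 t0 Q b l1 l2 gam <-> forall t, euler_lagrange_field l1 l2 gam t = 0.
  move=> /(admissible_monodromy_invariant Q_SO3 origin_on_axis s_axis) inv.
  exact: stationary_euler_lagrange.
have EL_local l1 l2 := locally_stationary_euler_lagrange l1 l2 sg gam_arc.
split=> [l1 l2 adm|]; first by rewrite EL_stat// EL_local.
split; rewrite EL_elastic; split=> -[l1 [l2 [adm EL]]]; exists l1, l2; split=> //.
- exact/EL_stat.
- exact/EL_stat.
- exact/EL_local.
- exact/EL_local.
Qed.
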